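(* Let $m\ge2$, $\gamma=(1,1)$, $\chi=m-2$. Given any formal system $\dot x=(x_2^{m-1},0)+\mathcal X(x)$ with $\mathrm{ord}_\gamma\mathcal X\ge\chi+1$ (i.e. all terms of $\mathcal X$ have ordinary degree at least $m$), there exists a near-identity formal transformation $x=y+\mathcal Q(y)$, $\mathrm{ord}_\gamma\mathcal Q\ge1$, that brings it into the generalized normal form (GNF) $$\dot y_1=y_2^{m-1}+\sum_{i=m}^\infty\sum_{j=0}^{m-3}Y_1^{(i-j,j)}y_1^{i-j}y_2^j+y_1^2y_2^{m-2}\sum_{i=0}^\infty Y_1^{(i+2,m-2)}y_1^i,$$ $$\dot y_2=\sum_{i=m}^\infty\sum_{j=0}^{m-2}Y_2^{(i-j,j)}y_1^{i-j}y_2^j+y_1y_2^{m-1}\sum_{i=0}^\infty Y_2^{(i+1,m-1)}y_1^i,$$ where for each $i\ge0$ we take either $Y_1^{(i+2,m-2)}=0$ or $Y_2^{(i+1,m-1)}=0$ (the choice being arbitrary for each $i$).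
   Context: Scalars are in $\mathbb K=\mathbb R$ or $\mathbb C$. With weight $\gamma=(1,1)$, a vector polynomial $(P_1,P_2)$ has generalized degree $k$ if $P_1,P_2$ are homogeneous of degree $k+1$; $\mathfrak V_\gamma^{[k]}$ is the space of these. $\mathrm{ord}_\gamma$ of a vector formal series is the least generalized degree of its nonzero components ($+\infty$ for the zero series). Vector polynomials are identified with vector fields: $\mathcal P(f)=P_1\partial_1f+P_2\partial_2f$ and $[\mathcal P,\mathcal Q]=(\mathcal P(Q_1)-\mathcal Q(P_1),\mathcal P(Q_2)-\mathcal Q(P_2))$. $Y_i^{(p_1,p_2)}$ is the coefficient of $y_1^{p_1}y_2^{p_2}$ in the perturbation component $Y_i$; empty sums are zero. Generalized normal form. Let $\mathcal H$ be the unperturbed part (of generalized degree $\chi$). For $k\ge1$ let $n_k=\dim\mathfrak V_\gamma^{[k+\chi]}-\dim[\mathcal H,\mathfrak V_\gamma^{[k]}]$, and let $\mathbf a_1^k,\dots,\mathbf a_{n_k}^k$ be the coefficient vectors (in the standard monomial basis of $\mathfrak V_\gamma^{[k+\chi]}$) of the $n_k$ linearly independent linear conditions (resonance equations) for solvability of the homological equation $[\mathcal H,\mathcal Q_\gamma^{[k]}]=\widetilde{\mathcal Y}_\gamma^{[k+\chi]}-\mathcal Y_\gamma^{[k+\chi]}$ in $\mathcal Q_\gamma^{[k]}\in\mathfrak V_\gamma^{[k]}$, i.e. a basis of the orthogonal complement of the image $[\mathcal H,\mathfrak V_\gamma^{[k]}]$. A resonant set consists, for each $k\ge1$, of $n_k$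 coefficients of $\mathcal Y_\gamma^{[k+\chi]}$, at positions $l_1,\dots,l_{n_k}$, such that $\det(\mathbf a^k_{i,l_j})_{i,j=1}^{n_k}\neq0$. The system $\dot y=\mathcal H(y)+\mathcal Y(y)$, $\mathrm{ord}_\gamma\mathcal Y\ge\chi+1$, is a GNF if all coefficients of $\mathcal Y$ are zero except for those from some resonant set, which have arbitrary values. Thus the claim that the displayed system is a GNF means that, for each choice made, the coefficients remaining in it form a resonant set. *)

(* Defs.v *)
From HB Require Import structures.
From mathcomp Require Import all_boot all_order all_algebra.
From mathcomp Require Import reals.
From mathcomp Require Import complex.
From mathcomp Require Import ring.

Set Implicit Arguments.
Unset Strict Implicit.
Unset Printing Implicit Defensive.

Import GRing.Theory.
Local Open Scope ring_scope.

Inductive scalars := Reals | Complexes.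

Definition scalar_field (R : realType) (s : scalars) : fieldType :=
  match s with Reals => R : fieldType | Complexes => complex R : fieldType end.

(* [f p q] is the coefficient of y_1^p y_2^q. *)
Definition fps (K : fieldType) := nat -> nat -> K.

(* The components 1 and 2 of a pair are indexed by 0 and 1 in 'I_2. *)
Definition vfps (K : fieldType) := 'I_2 -> fps K.

Section FormalSeries.
Variable K : fieldType.
Implicit Types (f g : fps K) (P Q F G T : vfps K).

Definition fps_one : fps K := fun p q => ((p == 0) && (q == 0))%N%:R.

Definition fps_add f g : fps K := fun p q => f p q + g p q.

Definition fps_mul f g : fps K := fun p q =>
  \sum_(i < p.+1) \sum_(j < q.+1) f i j * g (p - i)%N (q - j)%N.

Definition fps_exp f n : fps K := iter n (fps_mul f) fps_one.

Definition fps_partial (i : 'I_2) f : fps K := fun p q =>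
  if i == 0 then f p.+1 q *+ p.+1 else f p q.+1 *+ q.+1.

(* Substitution f(T_1, T_2) for T without constant terms: T_1^i T_2^j then only
   has terms of degree at least i + j, so the sum over all i, j is finite in
   each degree and the bounds below lose nothing. *)
Definition fps_subst f T : fps K := fun p q =>
  \sum_(i < (p + q).+1) \sum_(j < (p + q).+1)
    f i j * fps_mul (fps_exp (T 0) i) (fps_exp (T 1) j) p q.

Definition vfps_add P Q : vfps K := fun i => fps_add (P i) (Q i).

Definition vfps_id : vfps K := fun i p q =>
  if i == 0 then ((p == 1) && (q == 0))%N%:R else ((p == 0) && (q == 1))%N%:R.

Definition lie P f : fps K :=
  fps_add (fps_mul (P 0) (fps_partial 0 f)) (fps_mul (P 1) (fps_partial 1 f)).

Definition bracket P Q : vfps K := fun i p q =>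
  lie P (Q i) p q - lie Q (P i) p q.

(* ord_gamma P >= k for gamma = (1,1): generalized degree k is ordinary
   degree k + 1. *)
Definition ord_ge P (k : nat) :=
  forall i p q, (p + q < k.+1)%N -> P i p q = 0.

(* x = T(y) transforms dx/dt = F(x) into dy/dt = G(y): the derivative of T(y)
   along G is F(T(y)). *)
Definition transforms T F G :=
  forall i p q, lie G (T i) p q = fps_subst (F i) T p q.

(* The vector polynomials of generalized degree k are represented by their
   coefficients in the monomial basis: entry (i, p) of the matrix is the
   coefficient of y_1^p y_2^(k+1-p) in component i. *)
Definition vpoly k (A : 'M[K]_(2, k.+2)) : vfps K := fun i p q =>
  if (p + q == k.+1)%N then A i (inord p) else 0.

Definition hom_part k P : 'M[K]_(2, k.+2) :=
  \matrix_(i, p) P i p (k.+1 - p)%N.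

Section Resonance.
(* H is meant to be homogeneous of generalized degree chi. *)
Variables (H : vfps K) (chi : nat).

Definition homological k (A : 'M[K]_(2, k.+2)) : 'M[K]_(2, (k + chi).+2) :=
  hom_part (k + chi) (bracket H (vpoly A)).

Lemma homological_is_linear k : linear (@homological k).
Proof.
move=> a A B; apply/matrixP=> i p.
have vE (j : 'I_2) r s :
  vpoly (a *: A + B) j r s = a * vpoly A j r s + vpoly B j r s.
  by rewrite /vpoly; case: eqP => _; rewrite ?mxE ?mulr0 ?addr0.
have dE (l j : 'I_2) r s : fps_partial l (vpoly (a *: A + B) j) r s
   = a * fps_partial l (vpoly A j) r s + fps_partial l (vpoly B j) r s.
  by rewrite /fps_partial; case: ifP => _; rewrite vE mulrnDl mulrnAr.
have mr f (g g1 g2 : fps K) r s : (forall x y, g x y = a * g1 x y + g2 x y) ->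
    fps_mul f g r s = a * fps_mul f g1 r s + fps_mul f g2 r s.
  move=> gE; rewrite /fps_mul mulr_sumr -big_split; apply: eq_bigr => x _ /=.
  rewrite mulr_sumr -big_split; apply: eq_bigr => y _ /=.
  by rewrite gE mulrDr mulrCA.
have ml f (g g1 g2 : fps K) r s : (forall x y, g x y = a * g1 x y + g2 x y) ->
    fps_mul g f r s = a * fps_mul g1 f r s + fps_mul g2 f r s.
  move=> gE; rewrite /fps_mul mulr_sumr -big_split; apply: eq_bigr => x _ /=.
  rewrite mulr_sumr -big_split; apply: eq_bigr => y _ /=.
  by rewrite gE mulrDl mulrA.
rewrite !mxE /bracket /lie /fps_add.
rewrite !(mr _ _ _ _ _ _ (dE _ _)) !(ml _ _ _ _ _ _ (vE _)).
ring.
Qed.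

HB.instance Definition _ k :=
  GRing.isLinear.Build K 'M[K]_(2, k.+2) 'M[K]_(2, (k + chi).+2) _
    (@homological k) (@homological_is_linear k).

(* The row space is the image [H, V^[k]]. *)
Definition homological_mx k : 'M[K]_(2 * k.+2, 2 * (k + chi).+2) :=
  lin_mx (@homological k).

Definition nres k : nat := (2 * (k + chi).+2 - \rank (homological_mx k))%N.

(* The rows of [a] form a basis of the orthogonal complement of the image, for
   the bilinear pairing of coefficients: row i is the linear condition
   sum_l a i l * v_l = 0 on v for membership in the image. *)
Definition resonance_eqs k (a : 'M[K]_(nres k, 2 * (k + chi).+2)) : Prop :=
  row_free a /\ (a == kermx (homological_mx k)^T)%MS.

Lemma resonance_eqs_exist k : exists a, @resonance_eqs k a.
Proof.
have e : \rank (kermx (homological_mx k)^T) = nres k.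
  by rewrite mxrank_ker mxrank_tr.
rewrite /resonance_eqs; move: (nres k) e => _ <-.
exists (row_base (kermx (homological_mx k)^T)).
by rewrite row_base_free; split=> //; apply/eqmxP/eq_row_base.
Qed.

(* [S i p q] selects the position of the coefficient Y_i^(p,q). *)
Definition resonant_set (S : 'I_2 -> nat -> nat -> Prop) : Prop :=
  (forall i p q, S i p q -> (chi.+2 <= p + q)%N) /\
  forall k, (1 <= k)%N -> exists l : 'I_(nres k) -> 'I_2 * 'I_(k + chi).+2,
    (forall i (p : 'I_(k + chi).+2),
       S i p ((k + chi).+1 - p)%N <-> exists j, l j = (i, p)) /\
    forall a, @resonance_eqs k a ->
      \det (\matrix_(i, j) a i (mxvec_index (l j).1 (l j).2)) != 0.

(* dy/dt = H + Y is a generalized normal form, for the resonant set S. *)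
Definition is_GNF (S : 'I_2 -> nat -> nat -> Prop) Y : Prop :=
  [/\ resonant_set S, ord_ge Y chi.+1 &
      forall i p q, ~ S i p q -> Y i p q = 0].

End Resonance.

Definition unperturbed m : vfps K := fun i p q =>
  ((i == 0%R) && (p == 0) && (q == m.-1))%N%:R.

End FormalSeries.

(* Positions of the coefficients remaining in
     Y_1 = sum_(i >= m) sum_(0 <= j <= m-3) Y_1^(i-j,j) y_1^(i-j) y_2^j
           + y_1^2 y_2^(m-2) sum_(i >= 0) Y_1^(i+2,m-2) y_1^i,
     Y_2 = sum_(i >= m) sum_(0 <= j <= m-2) Y_2^(i-j,j) y_1^(i-j) y_2^j
           + y_1 y_2^(m-1) sum_(i >= 0) Y_2^(i+1,m-1) y_1^i,
   where, for each i, Y_1^(i+2,m-2) is taken to be 0 if z i = 0, and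
   Y_2^(i+1,m-1) is taken to be 0 if z i = 1. *)
Definition remaining (m : nat) (z : nat -> 'I_2) (c : 'I_2) (p q : nat) : Prop :=
  (if c == 0%R then
    (exists i j, [/\ m <= i, j + 3 <= m, p = i - j & q = j]) \/
    (exists i, [/\ z i != 0%R, p = i + 2 & q = m - 2])
  else
    (exists i j, [/\ m <= i, j + 2 <= m, p = i - j & q = j]) \/
    (exists i, [/\ z i != 1%R, p = i + 1 & q = m - 1]))%N.

(* Main.v *)
(* Write n = m - 1 and H = (y_2^n, 0). The bracket [H, Q] is
   (y_2^n d_1 Q_1 - n y_2^(n-1) Q_2, y_2^n d_1 Q_2), so in degree D its image is
   cut out by the vanishing of the coefficients of y_2^j with j <= n - 2 in the
   first component, those with j <= n - 1 in the second, and one relation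
   between y_1^(D-n+1) y_2^(n-1) in the first and y_1^(D-n) y_2^n in the second,
   both occurring with nonzero coefficients. The span of the remaining positions
   is thus a complement of the image, which is equivalent to the nonvanishing of
   the resonance determinant. The transformation is the limit of an iteration
   that solves the homological equation for the current defect of conjugacy:
   modulo higher degrees the defect is affine in the increments of Q and Y, with
   linear part [H, dQ] + dY, so each step clears one more degree. *)
Require Import Defs.
From mathcomp Require Import all_boot all_algebra reals.
From mathcomp Require Import boolp complex zify ring.

(** * Formal series modulo terms of high degree *)

Section TruncatedSeries.
Set Implicit Arguments.
Unset Strict Implicit.
Variable K : fieldType.
Implicit Types (f g h : fps K) (P Q T : vfps K).
Import GRing.Theory.
Local Open Scope ring_scope.

(** Degrees are ordinary here: [ord_ge P k] amounts to [low k.+1] for each component. *)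
Definition eqm d f g := forall p q, (p + q < d)%N -> f p q = g p q.

Definition low d f := eqm d f (fun _ _ => 0).

Definition monomial a b : fps K := fun p q => ((p == a) && (q == b))%N%:R.

Lemma fps_ext f g : (forall p q, f p q = g p q) -> f = g.
Proof. by move=> fg; apply/funext => p; apply/funext => q. Qed.

Lemma ord2P (P : 'I_2 -> Prop) : P 0 -> P 1 -> forall i, P i.
Proof.
move=> P0 P1 i.
by have [->|->] : i = 0 \/ i = 1; first
  by case: i => [[|[|//]]] ?; [left|right]; apply/val_inj.
Qed.

Lemma low_add d f g : low d f -> low d g -> low d (fps_add f g).
Proof. by move=> f0 g0 p q lt; rewrite /fps_add f0 // g0 // addr0. Qed.

Lemma low_weaken c d f : (c <= d)%N -> low d f -> low c f.
Proof. by move=> cd f0 p q lt; apply: f0; lia. Qed.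

Lemma low_mul a b f g : low a f -> low b g -> low (a + b) (fps_mul f g).
Proof.
move=> f0 g0 p q lt; rewrite /fps_mul.
rewrite big1 // => i _; rewrite big1 // => j _.
have := ltn_ord i; have := ltn_ord j => *.
have [fa|?] := ltnP (i + j) a; first by rewrite f0 // mul0r.
by rewrite g0 ?mulr0 //; lia.
Qed.

(** [e] is the precision beyond the leading orders: f g - f' g' = f (g - g') + (f - f') g', where
    both terms have order at least a + b + e. *)
Lemma fps_mul_eqm a b e f f' g g' : low a f -> low b g' ->
  eqm (a + e) f f' -> eqm (b + e) g g' ->
  eqm (a + b + e) (fps_mul f g) (fps_mul f' g').
Proof.
move=> f0 g0 ff gg p q lt; rewrite /fps_mul.
apply: eq_bigr => i _; apply: eq_bigr => j _.
have := ltn_ord i; have := ltn_ord j => *.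
have [fa|?] := ltnP (i + j) a; first by rewrite -ff ?f0 ?mul0r //; lia.
rewrite gg; last lia.
have [?|?] := ltnP (i + j) (a + e); first by rewrite ff.
by rewrite g0 ?mulr0 //; lia.
Qed.

Lemma fps_mulC f g : fps_mul f g = fps_mul g f.
Proof.
apply: fps_ext => p q; rewrite /fps_mul.
rewrite (reindex_inj rev_ord_inj); apply: eq_bigr => i _ /=.
rewrite (reindex_inj rev_ord_inj); apply: eq_bigr => j _ /=.
have := ltn_ord i; have := ltn_ord j => *.
by rewrite mulrC !subSS !subKn.
Qed.

Lemma fps_mulDr f g h :
  fps_mul f (fps_add g h) = fps_add (fps_mul f g) (fps_mul f h).
Proof.
apply: fps_ext => p q; rewrite /fps_mul /fps_add -big_split.
apply: eq_bigr => i _ /=; rewrite -big_split.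
by apply: eq_bigr => j _ /=; rewrite mulrDr.
Qed.

Lemma fps_mulDl f g h :
  fps_mul (fps_add g h) f = fps_add (fps_mul g f) (fps_mul h f).
Proof. by rewrite fps_mulC fps_mulDr !(fps_mulC f). Qed.

Lemma fps_mul0 f : fps_mul f (fun _ _ => 0) = fun _ _ => 0.
Proof.
apply: fps_ext => p q; rewrite /fps_mul big1 // => i _.
by rewrite big1 // => j _; rewrite mulr0.
Qed.

Lemma fps_mul0l f : fps_mul (fun _ _ => 0) f = fun _ _ => 0.
Proof. by rewrite fps_mulC fps_mul0. Qed.

Lemma fps_mulMn f g n :
  fps_mul f (fun p q => g p q *+ n) = fun p q => fps_mul f g p q *+ n.
Proof.
apply: fps_ext => p q; rewrite /fps_mul -sumrMnl; apply: eq_bigr => i _.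
by rewrite -sumrMnl; apply: eq_bigr => j _; rewrite mulrnAr.
Qed.

Lemma sum_delta n a (F : nat -> K) :
  \sum_(i < n) (i == a :> nat)%:R * F i = if (a < n)%N then F a else 0.
Proof.
case: ifP => an.
  rewrite (bigD1 (Ordinal an)) //= eqxx mul1r big1 ?addr0 // => i.
  by rewrite -val_eqE /= => /negPf ->; rewrite mul0r.
rewrite big1 // => i _; case: eqP => [ia|]; last by rewrite mul0r.
by have := ltn_ord i; rewrite ia an.
Qed.

Lemma monomial_mul a b g p q : fps_mul (monomial a b) g p q =
  if (a <= p)%N && (b <= q)%N then g (p - a)%N (q - b)%N else 0.
Proof.
rewrite /fps_mul /monomial.
transitivity (\sum_(i < p.+1) (i == a :> nat)%:R *
   \sum_(j < q.+1) (j == b :> nat)%:R * g (p - i)%N (q - j)%N).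
  apply: eq_bigr => i _; rewrite mulr_sumr; apply: eq_bigr => j _.
  by rewrite mulrA -natrM mulnb.
rewrite (sum_delta _ _ (fun i => \sum_(j < q.+1) (j == b :> nat)%:R * g (p - i)%N (q - j)%N)).
rewrite (sum_delta _ _ (fun j => g (p - a)%N (q - j)%N)) !ltnS.
by case: (a <= p)%N; case: (b <= q)%N.
Qed.

Lemma fps_mul1 f : fps_mul (fps_one K) f = f.
Proof. by apply: fps_ext => p q; rewrite monomial_mul !subn0. Qed.

Lemma low_monomial a b : low (a + b) (monomial a b).
Proof.
move=> p q lt; rewrite /monomial.
by have -> : (p == a) && (q == b) = false by lia.
Qed.

Lemma monomialM a b c d :
  fps_mul (monomial a b) (monomial c d) = monomial (a + c)%N (b + d)%N.
Proof.
apply: fps_ext => p q; rewrite monomial_mul /monomial.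
case: ifP => ab; first by congr (nat_of_bool _)%:R; lia.
have -> // : (p == a + c)%N && (q == b + d)%N = false by lia.
Qed.

Lemma monomial_exp a b n :
  fps_exp (monomial a b) n = monomial (n * a)%N (n * b)%N.
Proof.
elim: n => [|n IH]; first by [].
by rewrite /fps_exp iterS -/(fps_exp _ n) IH monomialM !mulSn.
Qed.

Lemma fps_expS f n : fps_exp f n.+1 = fps_mul f (fps_exp f n).
Proof. by []. Qed.

Lemma low_exp f n : low 1 f -> low n (fps_exp f n).
Proof.
move=> f0; elim: n => [|n IH]; first by move=> p q.
by rewrite fps_expS -add1n; apply: low_mul.
Qed.

Lemma fps_exp_eqm f g n e : low 1 f -> low 1 g -> eqm (1 + e) f g ->
  eqm (n + e) (fps_exp f n) (fps_exp g n).
Proof.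
move=> f0 g0 fg; elim: n => [|n IH]; first by [].
by rewrite !fps_expS -add1n; apply: fps_mul_eqm => //; apply: low_exp.
Qed.

(** Binomial expansion to first order. Terms quadratic in [h] have degree at least n - 2 + 2d >= n +
    d because d >= 2, and replacing f^(n-1) by y_2^(n-1) in the linear term only affects degrees
    from n + d on. *)
Lemma fps_exp_shift f h n d : (2 <= d)%N -> eqm 2 f (monomial 0 1) -> low d h ->
  eqm (n + d) (fps_exp (fps_add f h) n)
    (fps_add (fps_exp f n) (fun p q => fps_mul (monomial 0 n.-1) h p q *+ n)).
Proof.
move=> d2 fy h0.
have f1 : low 1 f.
  by move=> p q lt; rewrite fy ?(@low_monomial 0 1) //; lia.
have fh1 : low 1 (fps_add f h).
  by apply: low_add => //; apply: low_weaken h0; lia.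
have fhy : eqm (1 + 1) (fps_add f h) (monomial 0 1).
  by move=> p q lt; rewrite /fps_add fy // h0 ?addr0 //; lia.
elim: n => [|n IH].
  by move=> p q lt; rewrite /fps_add mulr0n addr0.
set D := fun p q => fps_mul (monomial 0 n.-1) h p q *+ n in IH.
have D0 : low (n.-1 + d) D.
  move=> p q lt; rewrite /D (low_mul (@low_monomial 0 n.-1) h0) ?mul0rn //.
have e1 : eqm (n.+1 + d) (fps_mul f (fps_exp (fps_add f h) n))
    (fps_mul f (fps_add (fps_exp f n) D)).
  rewrite -add1n; apply: fps_mul_eqm => //.
  apply: low_add; first exact: low_exp.
  by apply: low_weaken D0; lia.
have e2 : eqm (1 + (n.-1 + d) + 1) (fps_mul f D) (fps_mul (monomial 0 1) D).
  by apply: fps_mul_eqm.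
have e3 : eqm (d + n + 1) (fps_mul h (fps_exp (fps_add f h) n))
    (fps_mul h (monomial 0 n)).
  apply: fps_mul_eqm => //; first exact: (@low_monomial 0 n).
  rewrite (_ : monomial 0 n = fps_exp (monomial 0 1) n).
    by apply: fps_exp_eqm => //; exact: (@low_monomial 0 1).
  by rewrite monomial_exp muln0 muln1.
move=> p q lt; rewrite fps_expS fps_mulDl {1}/fps_add e1 // e3; last lia.
rewrite fps_mulDr {1}/fps_add e2; last lia.
rewrite /fps_add -addrA; congr (_ + _).
rewrite (fps_mulC h) mulrS addrC /D fps_mulMn; congr (_ + _).
(* For n = 0 the truncated [n.-1] is harmless, since its term carries multiplicity 0. *)
case: n {IH D D0 e1 e2 e3 lt} => [|n] //=.
rewrite !monomial_mul /= !subn0.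
case: ifP => q0; last by case: ifP => //; lia.
rewrite -subnDA add1n; congr (_ *+ _); case: ifP; case: ifP => //; lia.
Qed.

Lemma fps_substD f g T :
  fps_subst (fps_add f g) T = fps_add (fps_subst f T) (fps_subst g T).
Proof.
apply: fps_ext => p q; rewrite /fps_subst /fps_add -big_split.
apply: eq_bigr => i _ /=; rewrite -big_split.
by apply: eq_bigr => j _ /=; rewrite mulrDl.
Qed.

Lemma fps_subst0 T : fps_subst (fun _ _ => 0) T = fun _ _ => 0.
Proof.
apply: fps_ext => p q; rewrite /fps_subst big1 // => i _.
by rewrite big1 // => j _; rewrite mul0r.
Qed.

Lemma fps_subst_id f : fps_subst f (vfps_id K) = f.
Proof.
apply: fps_ext => p q; rewrite /fps_subst.
transitivity (\sum_(i < (p + q).+1) (i == p :> nat)%:R *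
   \sum_(j < (p + q).+1) (j == q :> nat)%:R * f i j).
  apply: eq_bigr => i _; rewrite mulr_sumr; apply: eq_bigr => j _.
  (* By conversion the components of [vfps_id] are [monomial 1 0] and [monomial 0 1]. *)
  rewrite !monomial_exp monomialM mulrC !muln1 !muln0 addn0 add0n mulrA -natrM.
  by rewrite mulnb /monomial (eq_sym p) (eq_sym q).
rewrite (sum_delta _ _ (fun i => \sum_(j < (p + q).+1) (j == q :> nat)%:R * f i j)).
by rewrite (sum_delta _ _ (fun j => f p j)) !ltnS leq_addr leq_addl.
Qed.

(** Each product T_1^i T_2^j is correct below degree i + j + e, and only those with i + j >= c
    occur. *)
Lemma fps_subst_eqm f T T' c e : low c f ->
  (forall i, low 1 (T i)) -> (forall i, low 1 (T' i)) ->
  (forall i, eqm (1 + e) (T i) (T' i)) ->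
  eqm (c + e) (fps_subst f T) (fps_subst f T').
Proof.
move=> f0 T1 T1' TT p q lt; rewrite /fps_subst.
apply: eq_bigr => i _; apply: eq_bigr => j _.
have [lc|?] := ltnP (i + j) c; first by rewrite f0 // !mul0r.
congr (_ * _).
have E : eqm (i + j + e) (fps_mul (fps_exp (T 0) i) (fps_exp (T 1) j))
    (fps_mul (fps_exp (T' 0) i) (fps_exp (T' 1) j)).
  by apply: fps_mul_eqm; [exact: low_exp | exact: low_exp
    | exact: fps_exp_eqm | exact: fps_exp_eqm].
by apply: E; lia.
Qed.

Lemma fps_subst_monomial n T : low 1 (T 1) ->
  fps_subst (monomial 0 n) T = fps_exp (T 1) n.
Proof.
move=> T1; apply: fps_ext => p q; rewrite /fps_subst.
transitivity (\sum_(i < (p + q).+1) (i == 0 :> nat)%N%:R *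
   \sum_(j < (p + q).+1) (j == n :> nat)%:R *
     fps_mul (fps_exp (T 0) i) (fps_exp (T 1) j) p q).
  apply: eq_bigr => i _; rewrite mulr_sumr; apply: eq_bigr => j _.
  by rewrite mulrA -natrM mulnb.
rewrite (sum_delta _ _ (fun i => \sum_(j < (p + q).+1) (j == n :> nat)%:R *
     fps_mul (fps_exp (T 0) i) (fps_exp (T 1) j) p q)) /=.
rewrite (sum_delta _ _ (fun j => fps_mul (fps_exp (T 0) 0) (fps_exp (T 1) j) p q)).
(* If n > p + q, the term lies outside the truncated sum, but the power has order at least n and
   vanishes here as well. *)
rewrite fps_mul1; case: ifP => // lt.
by rewrite (low_exp (n := n) T1) //; lia.
Qed.

Lemma fps_partialD l f g :
  fps_partial l (fps_add f g) = fps_add (fps_partial l f) (fps_partial l g).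
Proof.
by apply: fps_ext => p q; rewrite /fps_partial /fps_add; case: ifP; rewrite mulrnDl.
Qed.

Lemma low_partial l d f : low d.+1 f -> low d (fps_partial l f).
Proof.
by move=> f0 p q lt; rewrite /fps_partial; case: ifP => _; rewrite f0 ?mul0rn //; lia.
Qed.

Lemma partial_id l i :
  fps_partial l (vfps_id K i) = if l == i then fps_one K else fun _ _ => 0.
Proof.
apply: fps_ext => p q; move: l i.
apply: ord2P; apply: ord2P; rewrite /fps_partial /vfps_id /fps_one /=.
- by rewrite eqSS; case: p => [|p] //=; rewrite mul0rn.
- by rewrite mul0rn.
- by rewrite andbF mul0rn.
- by rewrite eqSS; case: q => [|q] //=; rewrite andbF mul0rn.
Qed.

(** The limit of a sequence that stabilizes degree by degree: since c > 0, coefficients of degree p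
    + q are final from index p + q on. *)
Lemma eqm_diag (f_ : nat -> fps K) c :
  (0 < c)%N -> (forall N, eqm (c + N) (f_ N.+1) (f_ N)) ->
  forall N, eqm (c + N) (fun p q => f_ (p + q)%N p q) (f_ N).
Proof.
move=> c0 stab N.
have H M M' : (M <= M')%N -> eqm (c + M) (f_ M') (f_ M).
  move=> MM p q lt; elim: M' MM => [|M' IH] MM.
    by have -> : M = 0%N by lia.
  have [->//|?] := eqVneq M M'.+1.
  by rewrite stab ?IH //; lia.
move=> p q lt; have [le|le] := leqP N (p + q); first exact: H.
by rewrite (H (p + q)%N N) //; lia.
Qed.

End TruncatedSeries.

(** * The bracket with [H] and the defect of conjugacy *)

Section NormalForm.
Set Implicit Arguments.
Unset Strict Implicit.
Variables (K : fieldType) (m : nat).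
Hypothesis m_ge2 : (2 <= m)%N.
Implicit Types (f g h : fps K) (P Q T X Y V : vfps K).
Import GRing.Theory.
Local Open Scope ring_scope.

Local Notation n := m.-1.
Local Notation H := (unperturbed K m).
Local Notation shift Q := (vfps_add (vfps_id K) Q).

Lemma unperturbed0 : H 0 = monomial K 0 n.
Proof. by []. Qed.

Lemma unperturbed1 : H 1 = fun _ _ => 0.
Proof. by []. Qed.

Lemma low_unperturbed i : low n (H i).
Proof. by move: i; apply: ord2P => //; exact: (@low_monomial K 0 n). Qed.

Lemma lie_unperturbed f p q :
  lie H f p q = if (n <= q)%N then f p.+1 (q - n)%N *+ p.+1 else 0.
Proof.
rewrite /lie unperturbed0 unperturbed1 fps_mul0l /fps_add addr0 monomial_mul.
by rewrite /= subn0.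
Qed.

Lemma lie_of_unperturbed P i p q : lie P (H i) p q =
  if i == 0 then fps_mul (monomial K 0 n.-1) (P 1) p q *+ n else 0.
Proof.
move: i; apply: ord2P; rewrite /lie /fps_add /=; last first.
  have E l : fps_partial l (H 1) = fun _ _ => 0.
    by apply: fps_ext => r s; rewrite /fps_partial; case: ifP => _; rewrite mul0rn.
  by rewrite !E !fps_mul0 addr0.
have -> : fps_partial 0 (H 0) = fun _ _ => 0.
  by apply: fps_ext => r s; rewrite /fps_partial /= mul0rn.
have -> : fps_partial 1 (H 0) = fun r s => monomial K 0 n.-1 r s *+ n.
  apply: fps_ext => r s; rewrite /fps_partial /= unperturbed0 /monomial.
  have -> : (s.+1 == n) = (s == n.-1) by lia.
  have [->|] := eqVneq s n.-1; last by rewrite andbF !mul0rn.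
  by rewrite prednK //; lia.
by rewrite fps_mul0 add0r fps_mulMn fps_mulC.
Qed.

Lemma bracketE P i p q : bracket H P i p q =
  (if (n <= q)%N then P i p.+1 (q - n)%N *+ p.+1 else 0)
  - (if (i == 0) && (n.-1 <= q)%N then P 1 p (q - n.-1)%N *+ n else 0).
Proof.
rewrite /bracket lie_unperturbed lie_of_unperturbed monomial_mul /= subn0.
by case: (i == 0) => //=; case: (n.-1 <= q)%N => //; rewrite mul0rn.
Qed.

(** The error in [transforms] for x = y + Q(y), from [H + X] to [H + Y]. *)
Definition defect X Q Y : vfps K := fun i p q =>
  lie (vfps_add H Y) (shift Q i) p q - fps_subst (vfps_add H X i) (shift Q) p q.

(** For the identity transformation and Y = 0 the terms [H] cancel and the defect is -X. *)
Lemma defect0 X i : low n.+1 (X i) ->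
  low n.+1 (defect X (fun _ _ _ => 0) (fun _ _ _ => 0) i).
Proof.
move=> X0 p q lt; rewrite /defect.
have add0 P : vfps_add P (fun _ _ _ => 0) = P.
  by apply/funext => j; apply: fps_ext => r s; rewrite /vfps_add /fps_add addr0.
rewrite !add0 fps_subst_id /vfps_add /fps_add X0 // addr0 /lie !partial_id.
move: i {X0}; apply: ord2P; rewrite /= fps_mul0 fps_mulC fps_mul1 /fps_add.
  by rewrite addr0 subrr.
by rewrite add0r subrr.
Qed.

Lemma low_shift Q : (forall i, low 2 (Q i)) -> forall i, low 1 (shift Q i).
Proof.
move=> Q0 i; apply: low_add; last by apply: low_weaken (Q0 i).
by move: i; apply: ord2P; [exact: (@low_monomial K 1 0)|exact: (@low_monomial K 0 1)].
Qed.

(* Only the terms linear in the increments survive in the lowest degree. *)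
Lemma defect_add X Q Y Q' Y' e i : (1 <= e)%N -> (forall j, low n.+1 (X j)) ->
  (forall j, low 2 (Q j)) -> (forall j, low n.+1 (Y j)) ->
  (forall j, low e.+1 (Q' j)) -> (forall j, low (n + e) (Y' j)) ->
  eqm (n + e).+1 (defect X (vfps_add Q Q') (vfps_add Y Y') i)
    (fps_add (defect X Q Y i) (fps_add (bracket H Q' i) (Y' i))).
Proof.
move=> e1 X0 Q0 Y0 Q0' Y0'.
have shiftD : shift (vfps_add Q Q') = vfps_add (shift Q) Q'.
  by apply/funext => j; apply: fps_ext => r s; rewrite /vfps_add /fps_add addrA.
have HYD : vfps_add H (vfps_add Y Y') = vfps_add (vfps_add H Y) Y'.
  by apply/funext => j; apply: fps_ext => r s; rewrite /vfps_add /fps_add addrA.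
(* The products of Y + Y' with dQ' and of Y' with dQ start in degree n + e + 1 and drop out. *)
have lieD l : eqm (n + e).+1
   (fps_mul (vfps_add (vfps_add H Y) Y' l) (fps_partial l (vfps_add (shift Q) Q' i)))
   (fps_add (fps_mul (vfps_add H Y l) (fps_partial l (shift Q i)))
     (fps_add (fps_mul (H l) (fps_partial l (Q' i)))
        (if l == i then Y' l else fun _ _ => 0))).
  rewrite {2}/vfps_add fps_partialD fps_mulDr {2}/vfps_add fps_mulDl.
  have a1 : eqm (n + e + 1) (fps_mul (vfps_add (vfps_add H Y) Y' l) (fps_partial l (Q' i)))
     (fps_mul (H l) (fps_partial l (Q' i))).
    have YY0 : low n.+1 (fps_add (Y l) (Y' l)).
      by apply: low_add => //; apply: low_weaken (Y0' l); lia.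
    rewrite -HYD; apply: fps_mul_eqm => //.
    - apply: low_add; first exact: low_unperturbed.
      by apply: low_weaken YY0; lia.
    - exact: low_partial.
    - by rewrite addn1 => r s lt; rewrite /vfps_add {1}/fps_add YY0 // addr0.
  have a2 : eqm (n + e + 0 + 1) (fps_mul (Y' l) (fps_partial l (shift Q i)))
     (if l == i then Y' l else fun _ _ => 0).
    have -> : (if l == i then Y' l else fun _ _ => 0) =
        fps_mul (Y' l) (fps_partial l (vfps_id K i)).
      by rewrite partial_id; case: eqP => _; rewrite ?fps_mul0 // fps_mulC fps_mul1.
    apply: fps_mul_eqm => // r s lt; rewrite {1}/vfps_add fps_partialD /fps_add.
    by rewrite (low_partial l (Q0 i)) ?addr0.
  move=> p q lt; rewrite /fps_add a1 ?a2; [ring|lia|lia].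
(* [X] has order n + 1, so an increment of order e + 1 changes it only from degree n + 1 + e on. *)
have substX : eqm (n.+1 + e) (fps_subst (X i) (vfps_add (shift Q) Q'))
    (fps_subst (X i) (shift Q)).
  rewrite -shiftD; apply: fps_subst_eqm => //; try apply: low_shift => // j.
    by apply: low_add => //; apply: low_weaken (Q0' j); lia.
  by move=> j r s lt; rewrite shiftD {1}/vfps_add /fps_add Q0' ?addr0.
(* This linearizes (y_2 + Q_2)^n; [fps_exp_shift] applies with d = e + 1, which is at least 2. *)
have substH : eqm (n + e.+1) (fps_subst (H i) (vfps_add (shift Q) Q'))
    (fps_add (fps_subst (H i) (shift Q)) (lie Q' (H i))).
  move: i {lieD substX}; apply: ord2P; last first.
    move=> p q lt; rewrite /fps_add lie_of_unperturbed unperturbed1 !fps_subst0.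
    by rewrite addr0.
  move=> p q lt; rewrite {1}/fps_add lie_of_unperturbed unperturbed0.
  rewrite !fps_subst_monomial; first last.
  - by apply: low_add; [exact: low_shift | apply: low_weaken (Q0' 1); lia].
  - exact: low_shift.
  rewrite /vfps_add (fps_exp_shift (d := e.+1)) //.
  by move=> r s rs; rewrite {1}/fps_add Q0 ?addr0.
have substD T : fps_subst (vfps_add H X i) T =
    fps_add (fps_subst (H i) T) (fps_subst (X i) T) by exact: fps_substD.
move=> p q lt; rewrite /defect shiftD HYD !substD {1}/lie {1}/fps_add !lieD //.
rewrite [in X in _ - X]/fps_add substX ?substH; [|lia|lia].
rewrite /bracket /lie /fps_add.
have -> : Y' i p q = (if 0 == i then Y' 0 else fun _ _ => 0) p q +
   (if 1 == i then Y' 1 else fun _ _ => 0) p q.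
  by move: i {lieD substX substH substD}; apply: ord2P;
    rewrite /= ?addr0 ?add0r.
rewrite /=; move: ((if 0 == i then _ else _) p q)
  ((if 1 == i then _ else _) p q) => u v.
ring.
Qed.


(** * Solving the homological equation off the remaining positions *)

Hypothesis natK_neq0 : forall k, (0 < k)%N -> k%:R != 0 :> K.
Variable z : nat -> 'I_2.

(** When p + q >= m, q = m - 2 forces p >= 2 and q = m - 1 forces p >= 1, so the subtractions inside
    [z] are not truncated. *)
Definition remainingb (c : 'I_2) p q : bool :=
  if c == 0 then (q + 3 <= m)%N || (q == m - 2)%N && (z (p - 2)%N != 0)
  else (q + 2 <= m)%N || (q == m - 1)%N && (z (p - 1)%N != 1).

Lemma remainingP c p q : (m <= p + q)%N ->
  remaining m z c p q <-> remainingb c p q.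
Proof.
move=> mpq; rewrite /remaining /remainingb; case: ifP => _; split.
- case=> [[i [j [? ? -> ->]]]|[i [zi -> ->]]]; first by apply/orP; left.
  by rewrite addnK eqxx zi orbT.
- case/orP => [?|/andP[/eqP ? zp]]; [left; exists (p + q)%N, q
    | right; exists (p - 2)%N].
    by split => //; lia.
  by split => //; lia.
- case=> [[i [j [? ? -> ->]]]|[i [zi -> ->]]]; first by apply/orP; left.
  by rewrite addnK eqxx zi orbT.
- case/orP => [?|/andP[/eqP ? zp]]; [left; exists (p + q)%N, q
    | right; exists (p - 1)%N].
    by split => //; lia.
  by split => //; lia.
Qed.

Lemma remaining_deg c p q : remaining m z c p q -> (m <= p + q)%N.
Proof.
by rewrite /remaining; case: ifP => _;
  case=> [[i [j [? ? -> ->]]]|[i [_ -> ->]]]; lia.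
Qed.

(* The coefficient of y_1^p enters two equations, one in each component, of
   which [z] picks the one to be solved; any other coefficient enters only one
   equation not already solved by the first component of [solve]. *)
Definition solve2 V : fps K := fun p q =>
  if p == 0%N then 0 else
  if (q == 0%N) && (z (p - 2)%N == 0) then - V 0 p n.-1 / n%:R
  else V 1 p.-1 (q + n)%N / p%:R.

(** With [solve2] as Q_2, the first component solves p Q_1^(p,q) - n Q_2^(p-1,q+1) = V_1^(p-1,q+n).
    Its terms in y_2 alone commute with [H] and are set to 0. *)
Definition solve V : vfps K := fun i p q =>
  if i == 0 then
    if p == 0%N then 0 else (V 0 p.-1 (q + n)%N + solve2 V p.-1 q.+1 *+ n) / p%:R
  else solve2 V p q.

Lemma low_solve V d : (forall i, low (n + d) (V i)) ->
  forall i, low d.+1 (solve V i).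
Proof.
move=> V0.
have s2 : low d.+1 (solve2 V).
  move=> p q lt; rewrite /solve2; case: eqP => // ?.
  by case: ifP => [/andP[/eqP ? _]|_]; rewrite V0 ?oppr0 ?mul0r //; lia.
apply: ord2P => //; move=> p q lt; rewrite /solve /=.
case: eqP => // ?; rewrite s2 ?V0 ?mul0rn ?addr0 ?mul0r //; lia.
Qed.

Lemma solveP V c p q : (m <= p + q)%N -> ~~ remainingb c p q ->
  bracket H (solve V) c p q = V c p q.
Proof.
move=> mpq; rewrite bracketE /remainingb.
move: c; apply: ord2P => /=; rewrite negb_or negb_and -ltnNge => /andP[q1 q2].
  have -> : (n.-1 <= q)%N by lia.
  (* For q >= n, Q_1 was chosen to absorb the term in Q_2. For q = n - 1 only Q_2^(p,0) occurs, and
     [z] assigns it to this equation. *)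
  have [qn|qn] := leqP n q.
    rewrite /solve /= subnK // -[_ *+ p.+1]mulr_natr divfK ?natK_neq0//.
    by rewrite (_ : (q - n).+1 = (q - n.-1)%N) ?addrK //; lia.
  have qE : q = n.-1 by lia.
  have zp : z (p - 2)%N == 0.
    by case/orP: q2 => [/eqP|/negPn//]; lia.
  rewrite /solve /= /solve2 qE subnn zp /=.
  case: eqP => [?|_]; first lia.
  by rewrite -[_ / _ *+ n]mulr_natr divfK ?natK_neq0 // ?sub0r ?opprK //; lia.
have -> : (n <= q)%N by lia.
rewrite subr0 /solve /solve2 /=.
(* At q = n the omitted position has z (p - 1) = 1, so [solve2] takes its last branch; for q > n it
   does so because q - n is nonzero. *)
have [qn|qn] := eqVneq q n.
  have /negPf -> : z (p.+1 - 2)%N != 0.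
    have -> : (p.+1 - 2 = p - 1)%N by lia.
    by case/orP: q2 => [/eqP|/negPn/eqP->//]; lia.
  by rewrite andbF subnK ?qn // -[_ / _ *+ _]mulr_natr divfK ?natK_neq0.
have /negPf -> : (q - n)%N != 0%N by lia.
rewrite andFb subnK; last lia.
by rewrite -[_ / _ *+ _]mulr_natr divfK ?natK_neq0.
Qed.

(** The image meets the span of the remaining positions only in 0. Those with smaller q are never
    reached by [H, .]; at y_1^p y_2^(n-1) in the first component and y_1^(p-1) y_2^n in the second,
    the bracket has nonzero multiples of the same P_2^(p,0), and [z] omits one of the two
    positions. *)
Lemma bracket_remaining P :
  (forall c p q, (m <= p + q)%N -> ~~ remainingb c p q ->
    bracket H P c p q = 0) ->
  forall c p q, (m <= p + q)%N -> bracket H P c p q = 0.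
Proof.
move=> P0 c p q mpq; have [|] := boolP (remainingb c p q); last exact: P0.
rewrite /remainingb; move: c; apply: ord2P => /=.
  case/orP => [?|/andP[/eqP qE zp]].
    by rewrite bracketE /= !ifF ?subr0 //; lia.
  (* The twin position in the second component is omitted, and its coefficient is p times
     P_2^(p,0). *)
  have := P0 1 p.-1 n; rewrite /remainingb !bracketE /= leqnn subnn subr0.
  have -> : (p.-1 - 1 = p - 2)%N by lia.
  have -> : (z (p - 2)%N != 1) = false.
    by move: zp; move: (z _); apply: ord2P.
  rewrite andbF orbF -ltnNge prednK; last lia.
  move=> /(_ ltac:(lia) ltac:(lia)) /eqP.
  rewrite -mulr_natr mulf_eq0 (negPf (natK_neq0 _)) ?orbF; last lia.
  move=> /eqP Pp0; rewrite ifF; last lia.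
  have qn0 : (q - n.-1 = 0)%N by lia.
  by rewrite qn0 Pp0 mul0rn if_same subr0.
case/orP => [?|/andP[/eqP qE zp]].
  by rewrite bracketE /= ifF ?subr0 //; lia.
(* Conversely, the twin in the first component carries -n P_2^(p+1,0). *)
have := P0 0 p.+1 n.-1; rewrite /remainingb !bracketE /= leqnn subnn.
have -> : (p.+1 - 2 = p - 1)%N by lia.
have -> : (z (p - 1)%N != 0) = false.
  by move: zp; move: (z _); apply: ord2P.
rewrite andbF orbF -ltnNge.
move=> /(_ ltac:(lia) ltac:(lia)) /eqP.
rewrite ifF ?sub0r; last lia.
rewrite oppr_eq0 -mulr_natr mulf_eq0 (negPf (natK_neq0 _)) ?orbF; last lia.
move=> /eqP Pp0.
have qn0 : (q - n = 0)%N by lia.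
by rewrite qn0 Pp0 mul0rn if_same subr0.
Qed.

Lemma low_bracket P d : (forall i, low d.+1 (P i)) ->
  forall i, low (n + d) (bracket H P i).
Proof.
move=> P0 i p q lt; rewrite bracketE.
by case: ifP; case: ifP => *; rewrite ?P0 ?mul0rn ?subr0 //; lia.
Qed.

(** * The iteration and its limit *)

Section Iteration.
Variable X : vfps K.
Hypothesis lowX : forall i, low n.+1 (X i).

(** The increment of Y is the residue left by [solve], so [H, dQ] + dY = V holds exactly, while
    [solveP] confines dY to remaining positions in degrees at least m. *)
Definition improve (QY : vfps K * vfps K) : vfps K * vfps K :=
  let V : vfps K := fun i p q => - defect X QY.1 QY.2 i p q in
  (vfps_add QY.1 (solve V),
   vfps_add QY.2 (fun i p q => V i p q - bracket H (solve V) i p q)).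

Definition approx N := iter N improve (fun _ _ _ => 0, fun _ _ _ => 0).

Definition good N (QY : vfps K * vfps K) : Prop :=
  [/\ forall i, low 2 (QY.1 i), forall i, low n.+1 (QY.2 i),
      forall i p q, (m <= p + q)%N -> ~~ remainingb i p q -> QY.2 i p q = 0 &
      forall i, low (n + N).+1 (defect X QY.1 QY.2 i)].

Lemma improveP N QY : good N QY ->
  [/\ good N.+1 (improve QY),
      forall i, eqm (2 + N) ((improve QY).1 i) (QY.1 i) &
      forall i, eqm (n.+1 + N) ((improve QY).2 i) (QY.2 i)].
Proof.
case: QY => Q Y [/= Q0 Y0 YS E0]; rewrite /improve /=.
set V : vfps K := fun i p q => - defect X Q Y i p q.
have V0 i : low (n + N.+1) (V i).
  by move=> p q lt; rewrite /V E0 ?oppr0 //; lia.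
have S0 := low_solve V0.
have B0 := low_bracket S0.
set W : vfps K := fun i p q => V i p q - bracket H (solve V) i p q.
have W0 i : low (n + N.+1) (W i).
  by move=> p q lt; rewrite /W V0 // B0 // subrr.
split; first split => /=.
- by move=> i; apply: low_add => //; apply: low_weaken (S0 i); lia.
- by move=> i; apply: low_add => //; apply: low_weaken (W0 i); lia.
- by move=> i p q mpq nS; rewrite /vfps_add /fps_add YS // /W solveP // subrr addr0.
(* With e = N + 1, the new defect is the old one plus V, which is 0, up to degree n + N + 1. *)
- move=> i p q lt; rewrite (@defect_add X Q Y _ _ N.+1) //.
  by rewrite /fps_add /W /V; ring.
- by move=> i p q lt; rewrite /vfps_add /fps_add S0 ?addr0.
- by move=> i p q lt; rewrite /vfps_add /fps_add W0 ?addr0 //; lia.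
Qed.

Lemma approxP N : good N (approx N).
Proof.
elim: N => [|N IH]; last by case: (improveP IH).
by split=> // i; rewrite addn0; apply: defect0.
Qed.

Lemma normal_form_exists : exists Q Y : vfps K,
  [/\ forall i, low 2 (Q i), forall i, low n.+1 (Y i),
      forall i p q, (m <= p + q)%N -> ~~ remainingb i p q -> Y i p q = 0 &
      forall i p q, defect X Q Y i p q = 0].
Proof.
pose Q : vfps K := fun i p q => (approx (p + q)).1 i p q.
pose Y : vfps K := fun i p q => (approx (p + q)).2 i p q.
have QE i N : eqm (2 + N) (Q i) ((approx N).1 i).
  apply: (@eqm_diag _ (fun N => (approx N).1 i)) => // {}N.
  by case: (improveP (approxP N)).
have YE i N : eqm (n.+1 + N) (Y i) ((approx N).2 i).
  apply: (@eqm_diag _ (fun N => (approx N).2 i)) => // {}N.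
  by case: (improveP (approxP N)).
exists Q, Y; split.
- move=> i p q lt; rewrite (QE i 0%N) //.
- move=> i p q lt; rewrite (YE i 0%N) //; lia.
- by move=> i p q mpq nS; case: (approxP (p + q)) => _ _ + _; apply.
(* The limit differs from [approx N] by increments of orders N + 2 and n + N + 1, too high to change
   the defect in degree N. *)
move=> i p q; set N := (p + q)%N; have [Q0 Y0 _ E0] := approxP N.
pose dQ : vfps K := fun i p q => Q i p q - (approx N).1 i p q.
pose dY : vfps K := fun i p q => Y i p q - (approx N).2 i p q.
have dQ0 j : low N.+2 (dQ j) by move=> r s lt; rewrite /dQ (QE j N) ?subrr.
have dY0 j : low (n + N.+1) (dY j).
  by move=> r s lt; rewrite /dY (YE j N) ?subrr //; lia.
have -> : Q = vfps_add (approx N).1 dQ.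
  apply/funext => j; apply: fps_ext => r s; rewrite /vfps_add /fps_add /dQ; ring.
have -> : Y = vfps_add (approx N).2 dY.
  apply/funext => j; apply: fps_ext => r s; rewrite /vfps_add /fps_add /dY; ring.
rewrite (@defect_add X _ _ _ _ N.+1) //; last lia.
rewrite /fps_add E0 ?(low_bracket dQ0) ?dY0 ?addr0 //; lia.
Qed.

End Iteration.

End NormalForm.

(** * Linear algebra: coordinate subspaces complementary to a row space *)

Section ComplementaryCoordinates.
Set Implicit Arguments.
Unset Strict Implicit.
Variables (K : fieldType) (r N c : nat).
Variables (M : 'M[K]_(r, N)) (l : 'I_c -> 'I_N).
Import GRing.Theory.
Local Open Scope ring_scope.

Hypothesis decomposition : forall v : 'rV[K]_N, exists u : 'rV[K]_r,
  forall j, j \notin codom l -> (v - u *m M) 0 j = 0.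

(** A combination of rows of [a] vanishing at the selected coordinates is orthogonal to the row
    space of [M] and to the selected unit vectors, hence to everything by [decomposition]. So it is
    0, and trivial by freeness. *)
Lemma minor_neq0 (a : 'M[K]_(c, N)) : row_free a -> (a <= kermx M^T)%MS ->
  \det (\matrix_(i, j) a i (l j)) != 0.
Proof.
move=> fa /sub_kermxP aM; rewrite -unitfE -[_ \is a _]unitmxE -row_free_unit.
apply: inj_row_free => x x0.
apply: (row_free_inj fa); rewrite mul0mx; set w := x *m a.
have wM : w *m M^T = 0 by rewrite /w -mulmxA aM mulmx0.
have wl j : w 0 (l j) = 0.
  have /matrixP/(_ 0 j) := x0; rewrite /w !mxE => x0l; rewrite -[RHS]x0l.
  by apply: eq_bigr => i _; rewrite !mxE.
apply/rowP => t; pose e : 'rV[K]_N := delta_mx 0 t; have [u uP] := decomposition e.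
have : (w *m e^T) 0 0 = 0.
  rewrite -(subrK (u *m M) e) raddfD /= mulmxDr trmx_mul mulmxA wM mul0mx addr0.
  rewrite !mxE big1 // => j _; rewrite [(_ ^T) _ _]mxE.
  have [/codomP[i ->]|nj] := boolP (j \in codom l); first by rewrite wl mul0r.
  by rewrite uP // mulr0.
by rewrite trmx_delta -colE !mxE.
Qed.

Hypothesis l_inj : injective l.
Hypothesis trivial_meet : forall u : 'rV[K]_r,
  (forall j, j \notin codom l -> (u *m M) 0 j = 0) -> u *m M = 0.

(** The rows of [E] are the selected unit vectors. Their span and the row space of [M] form a direct
    sum equal to the whole space, so the ranks add up to [N]. *)
Lemma card_complement : (N - \rank M)%N = c.
Proof.
pose E : 'M[K]_(c, N) := \matrix_(i, j) (j == l i)%:R.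
have uE (u : 'rV_c) j : (u *m E) 0 j = \sum_i u 0 i * (j == l i)%:R.
  by rewrite !mxE; apply: eq_bigr => i _; rewrite !mxE.
have uEl (u : 'rV_c) i : (u *m E) 0 (l i) = u 0 i.
  rewrite uE (bigD1 i) //= eqxx mulr1 big1 ?addr0 // => k ki.
  by rewrite (inj_eq l_inj) eq_sym (negPf ki) mulr0.
have uEn (u : 'rV_c) j : j \notin codom l -> (u *m E) 0 j = 0.
  move=> jl; rewrite uE big1 // => i _.
  case: eqP => [jE|]; last by rewrite mulr0.
  by rewrite jE codom_f in jl.
have fE : \rank E = c.
  apply/eqP; rewrite -[_ == _]/(row_free E); apply: inj_row_free => u u0.
  by apply/rowP => i; rewrite -uEl u0 !mxE.
have cap0 : (M :&: E)%MS = 0.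
  apply/eqP/rowV0P => v; rewrite sub_capmx => /andP[/submxP[u vM] /submxP[x vE]].
  rewrite vM; apply: trivial_meet => j jl; by rewrite -vM vE uEn.
have full : row_full (M + E)%MS.
  rewrite -sub1mx; apply/row_subP => i; have [u uP] := decomposition (row i 1%:M).
  rewrite -(subrK (u *m M) (row i 1%:M)); set v := _ - _.
  have -> : v = (\row_k v 0 (l k)) *m E.
    apply/rowP => j; have [/codomP[k ->]|nj] := boolP (j \in codom l).
      by rewrite uEl [RHS]mxE.
    by rewrite uEn ?uP.
  by rewrite [(_ + u *m M)%R]addrC addmx_sub_adds ?submxMl.
have := mxrank_disjoint_sum cap0; rewrite fE (eqP full) => NE.
by rewrite [X in (X - _)%N]NE addKn.
Qed.

End ComplementaryCoordinates.

(** * The remaining positions form a resonant set *)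

Section ResonantSet.
Set Implicit Arguments.
Unset Strict Implicit.
Variables (K : fieldType) (m : nat).
Hypothesis m_ge2 : (2 <= m)%N.
Import GRing.Theory.
Local Open Scope ring_scope.
Hypothesis natK_neq0 : forall k, (0 < k)%N -> k%:R != 0 :> K.
Variable z : nat -> 'I_2.
Local Notation H := (unperturbed K m).
Local Notation chi := (m - 2)%N.

(** [H] is homogeneous, so this part of the bracket depends only on the part of [P] of generalized
    degree k. This carries [solve] over to coefficient matrices. *)
Lemma homological_hom_part k (P : vfps K) :
  homological H chi (hom_part k P) = hom_part (k + chi) (bracket H P).
Proof.
apply/matrixP => i p; rewrite !mxE !bracketE //.
have E j r s : (r + s = k.+1)%N -> vpoly (hom_part k P) j r s = P j r s.
  move=> rs; rewrite /vpoly rs eqxx mxE inordK; last lia.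
  by congr (P _ _ _); lia.
have := ltn_ord p => *.
by congr (_ - _); case: ifP => // ?; rewrite E //; lia.
Qed.

(** In each degree, [solveP] shows that the image and the remaining positions span, and
    [bracket_remaining] that they meet trivially. *)
Lemma resonant_set_remaining : resonant_set H chi (remaining m z).
Proof.
split=> [c p q|k k1].
  by move=> /(@remaining_deg _ m_ge2) ?; lia.
pose D := (k + chi).+2.
pose pos (x : 'I_2 * 'I_D) := remainingb m z x.1 x.2 ((k + chi).+1 - x.2)%N.
have deg (p : 'I_D) : (m <= p + ((k + chi).+1 - p))%N.
  by have := ltn_ord p; rewrite /D; lia.
pose S := [set x | pos x].
pose l (j : 'I_#|S|) : 'I_2 * 'I_D := enum_val j.
pose M := homological_mx H chi k.
have idx_inj : injective (fun x : 'I_2 * 'I_D => mxvec_index x.1 x.2).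
  have [g gK _] := curry_mxvec_bij 2 D.
  by apply: (can_inj (g := g)) => -[i p]; apply: (gK (i, p)).
pose L j := mxvec_index (l j).1 (l j).2.
have L_inj : injective L by move=> i j /idx_inj/enum_val_inj.
have codomL i p : (mxvec_index i p \in codom L) = pos (i, p).
  apply/codomP/idP => [[j e]|ip].
    have -> : (i, p) = l j by apply: idx_inj.
    by have := enum_valP j; rewrite inE.
  have ipS : (i, p) \in S by rewrite inE.
  by exists (enum_rank_in ipS (i, p)); rewrite /L /l enum_rankK_in.
have dec (v : 'rV[K]_(2 * D)) : exists u : 'rV[K]_(2 * k.+2),
    forall j, j \notin codom L -> (v - u *m M) 0 j = 0.
  pose V := vpoly (vec_mx v).
  exists (mxvec (hom_part k (solve m z V))) => j.
  case/mxvec_indexP: j => i p; rewrite codomL => nS.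
  rewrite /M /homological_mx mul_rV_lin mxvecK /= homological_hom_part.
  rewrite -[v in v - _]vec_mxK -raddfB mxvecE [LHS]mxE [X in _ + X]mxE [X in _ - X]mxE.
  rewrite solveP // /V /vpoly.
  have := ltn_ord p => *; rewrite subnKC ?eqxx ?inord_val ?subrr //; lia.
have meet (u : 'rV[K]_(2 * k.+2)) :
    (forall j, j \notin codom L -> (u *m M) 0 j = 0) -> u *m M = 0.
  rewrite /M /homological_mx mul_rV_lin /= => u0.
  suff -> : homological H chi (vec_mx u) = 0 by rewrite linear0.
  apply/matrixP => i p; rewrite !mxE.
  apply: (@bracket_remaining K m m_ge2 natK_neq0 z) => // c r s mrs nS.
  (* [bracket_remaining] asks for every degree from m on; outside ordinary degree k + chi + 1 the
     bracket of a homogeneous field with [H] vanishes. *)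
  have [rs|nrs] := eqVneq (r + s)%N (k + chi).+1; last first.
    rewrite bracketE // /vpoly -[RHS](subrr (0 : K)); congr (_ - _);
      by case: ifP => // ?; rewrite ifF ?mul0rn //; lia.
  have rD : (r < D)%N by rewrite /D; lia.
  have := u0 (mxvec_index c (Ordinal rD)).
  rewrite codomL mxvecE mxE /pos /=.
  have -> : ((k + chi).+1 - r = s)%N by lia.
  exact.
(* The count of remaining positions is the codimension of the image, which allows reindexing [l] by
   the resonance equations. *)
have nS : #|S| = nres H chi k by rewrite /nres -(card_complement dec L_inj meet).
exists (fun j => l (cast_ord (esym nS) j)); split.
  move=> i p; rewrite remainingP //; split => [ip|[j e]].
    have ipS : (i, p) \in S by rewrite inE.
    exists (cast_ord nS (enum_rank_in ipS (i, p))).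
    by rewrite cast_ordK /l enum_rankK_in.
  by have := enum_valP (cast_ord (esym nS) j); rewrite -/(l _) e inE.
move=> a [fa aE].
have aK : (a <= kermx M^T)%MS by case/andP: aE.
apply: (minor_neq0 (M := M) (l := fun j => L (cast_ord (esym nS) j))) => // v.
have [u uP] := dec v; exists u => j nj; apply: uP; apply: contra nj.
case/codomP => i ->; apply/codomP; exists (cast_ord nS i).
by rewrite cast_ordK.
Qed.

End ResonantSet.

(** * Characteristic zero of the scalars, and the conclusion *)

Lemma scalar_field_natr_neq0 (R : realType) (s : scalars) k :
  0 < k -> (k%:R != 0 :> scalar_field R s)%R.
Proof.
move=> k_gt0; have nat_neq0 (F : numDomainType) : (k%:R != 0 :> F)%R.
  by rewrite Num.Theory.pnatr_eq0 -lt0n.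
by case: s; [exact: (nat_neq0 R) | exact: (nat_neq0 (complex R))].
Qed.

Theorem corollary1 (R : realType) (s : scalars) (m : nat) (hm : (2 <= m)%N)
    (X : vfps (scalar_field R s)) (hX : ord_ge X (m - 2).+1)
    (z : nat -> 'I_2) :
  exists Q Y : vfps (scalar_field R s),
    [/\ ord_ge Q 1,
        transforms (vfps_add (vfps_id _) Q)
          (vfps_add (unperturbed _ m) X) (vfps_add (unperturbed _ m) Y) &
        is_GNF (unperturbed _ m) (m - 2) (remaining m z) Y].
Proof.
have K0 := @scalar_field_natr_neq0 R s.
have X0 i : low m.-1.+1 (X i).
  by move=> p q lt; apply: hX; lia.
have [Q [Y [Q0 Y0 YS E0]]] := normal_form_exists hm K0 z X0.
exists Q, Y; split.
- by move=> i p q; apply: Q0.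
- by move=> i p q; apply/eqP; rewrite -GRing.subr_eq0; apply/eqP/E0.
split.
- exact: resonant_set_remaining.
- by move=> i p q lt; apply: Y0; lia.
(* [remaining] and [remainingb] agree only from degree m on; below it the order of Y decides. *)
move=> i p q nS; have [lt|le] := ltnP (p + q) m; first by apply: Y0; lia.
by apply: YS => //; apply/negP => /(remainingP hm z i le).
Qed.
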